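(* (Frobenius reciprocity for permutation representations) Let $G$ be a finite group acting transitively on $X$, let $K$ be the stabilizer of $x_0\in X$, and let $(\rho,V)$ be an irreducible representation of $G$ with $V^K$ nontrivial; set $d_\rho=\dim V$. The map $$V^K\longrightarrow\mathrm{Hom}_G(V,L(X)),\qquad v\longmapsto\frac{1}{\sqrt{d_\rho}}T_v$$ is an antilinear, isometric isomorphism between the vector spaces $V^K$ and $\mathrm{Hom}_G(V,L(X))$. In particular, the multiplicity of $V$ in $L(X)$ is equal to $\dim V^K$, the dimension of the subspace of $K$-invariant vectors in $V$.
   Context: Representations are finite-dimensional, complex and unitary; inner products are linear in the first variable. $V^K$ is the subspace of $K$-invariant vectors. $L(X)$ is the space of complex functions on $X$ with $\langle f_1,f_2\rangle=\sum_xf_1(x)\overline{f_2(x)}$ and permutation representation $(\lambda(g)f)(x)=f(g^{-1}x)$. For $v\in V^K$, $T_v:V\to L(X)$ is the linear map $(T_vw)(gx_0)=\sqrt{\frac{d_\rho}{|X|}}\,\langle w,\rho(g)v\rangle_V$ for $w\in V$, $g\in G$ (it is well defined and commutes with $G$). $\mathrm{Hom}_G(V,L(X))$ is the space of $G$-intertwining linear operators, with the Hilbert--Schmidt inner product $\langle S,T\rangle_{HS}=\sum_k\langle Su_k,Tu_k\rangle$ for any orthonormal basis $(u_k)$ of $V$. *)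

(* Defs.v *)
From HB Require Import structures.
From mathcomp Require Import all_boot all_order all_algebra all_fingroup.
From mathcomp Require Import boolp reals.
From mathcomp Require Export complex.

Set Implicit Arguments.
Unset Strict Implicit.
Unset Printing Implicit Defensive.

Import Order.TTheory GRing.Theory Num.Theory.

Local Open Scope ring_scope.

(* [{action gT &-> X}] is a right action, whereas the formulas for [lambda] and
   [T_v] use a left one. *)
Definition is_left_action (gT : finGroupType) (X : Type) (act : gT -> X -> X) :=
  (forall x, act 1%g x = x) /\
  (forall g h x, act (g * h)%g x = act g (act h x)).

Definition is_transitive (gT : finGroupType) (X : Type) (act : gT -> X -> X) :=
  forall x y, exists g, act g x = y.

Definition stabilizer (gT : finGroupType) (X : finType) (act : gT -> X -> X)
    (x0 : X) : {set gT} := [set g | act g x0 == x0].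

Section Representations.
Variables (C : numClosedFieldType) (gT : finGroupType).

Definition is_rep (V : vectType C) (rho : gT -> 'End(V)) :=
  rho 1%g = \1%VF /\ forall g h, rho (g * h)%g = (rho g \o rho h)%VF.

Definition unitary_rep (V : vectType C) (dot : {dot V for Num.conj})
    (rho : gT -> 'End(V)) :=
  forall g v w, dot (rho g v) (rho g w) = dot v w.

Definition stable (V : vectType C) (rho : gT -> 'End(V)) (U : {vspace V}) :=
  forall g, (rho g @: U <= U)%VS.

Definition irreducible_on (V : vectType C) (rho : gT -> 'End(V))
    (W : {vspace V}) :=
  [/\ W <> 0%VS, stable rho W &
      forall U : {vspace V}, (U <= W)%VS -> stable rho U -> U = 0%VS \/ U = W].

Definition irreducible_rep (V : vectType C) (rho : gT -> 'End(V)) :=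
  irreducible_on rho fullv.

Definition invariants (V : vectType C) (rho : gT -> 'End(V)) (K : {set gT}) :
    {vspace V} := (\bigcap_(k in K) fixedSpace (rho k))%VS.

Lemma mem_invariants (V : vectType C) (rho : gT -> 'End(V)) (K : {set gT}) v :
  v \in invariants rho K <-> {in K, forall k, rho k v = v}.
Proof.
have E : (v \in invariants rho K) =
    [forall (k | k \in K), v \in fixedSpace (rho k)].
  rewrite memvE; apply/subv_bigcapP/'forall_implyP => h k /h; by rewrite memvE.
rewrite E; split=> [/'forall_implyP h k /h/fixedSpaceP //|h].
by apply/'forall_implyP => k /h /fixedSpaceP.
Qed.

Section Intertwiners.
Variables (V W : vectType C) (rho : gT -> 'End(V)) (lam : gT -> 'End(W)).

Definition intertwine_defect (g : gT) (T : 'Hom(V, W)) : 'Hom(V, W) :=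
  (T \o rho g)%VF - (lam g \o T)%VF.

Lemma intertwine_defect_is_linear g : linear (intertwine_defect g).
Proof.
move=> a S T; rewrite /intertwine_defect comp_lfunDl comp_lfunDr.
by rewrite -comp_lfunZl -comp_lfunZr scalerBr opprD addrACA.
Qed.

HB.instance Definition _ g := GRing.isLinear.Build C 'Hom(V, W) 'Hom(V, W) *:%R
  (intertwine_defect g) (intertwine_defect_is_linear g).

Definition homG : {vspace 'Hom(V, W)} :=
  (\bigcap_(g : gT) lker (linfun (intertwine_defect g)))%VS.

Lemma mem_homG T : T \in homG <-> forall g, (T \o rho g = lam g \o T)%VF.
Proof.
rewrite memvE; split=> [/subv_bigcapP h g|h].
  have := h g isT; rewrite -memvE memv_ker lfunE /= => /eqP/subr0_eq //.
apply/subv_bigcapP => g _; rewrite -memvE memv_ker lfunE /=.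
by rewrite /intertwine_defect h subrr.
Qed.

Definition equivalent_to_sub (U : {vspace W}) :=
  exists T : 'Hom(V, W), [/\ T \in homG, lker T = 0%VS & limg T = U].

(* Uniqueness of [m] is not built in: [is_multiplicity m <-> m = m0] says both
   that a decomposition into irreducibles exists and that every one of them has
   exactly [m0] summands equivalent to [rho]. *)
Definition is_multiplicity (m : nat) :=
  exists n (U : 'I_n -> {vspace W}),
    [/\ (\sum_(i < n) U i = fullv)%VS, directv (\sum_(i < n) U i),
        forall i, irreducible_on lam (U i) &
        m = #|[set i | `[< equivalent_to_sub (U i) >]]|].

End Intertwiners.

Definition orthonormal_basis (V : vectType C) (dot : {dot V for Num.conj})
    (e : seq V) := orthonormal dot e && basis_of fullv e.

Lemma orthonormal_basis_exists (V : vectType C) (dot : {dot V for Num.conj}) :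
  exists e, orthonormal_basis dot e.
Proof.
suff H n (U : {vspace V}) : \dim U = n ->
    exists e, orthonormal dot e && basis_of U e by apply: (H _ fullv erefl).
elim: n U => [|n IH] U dU.
  exists [::]; rewrite /= basisEdim span_nil dU.
  by move/eqP: dU; rewrite dimv_eq0 => /eqP->; rewrite sub0v.
pose v := vpick U.
have v0 : v != 0 by rewrite vpick0 -dimv_eq0 dU.
have vv0 : 0 < dot v v by rewrite dnorm_gt0.
have vN : v \notin orthov dot U.
  by apply/mem_orthovPn; exists v; rewrite ?memv_pick ?lt0r_neq0.
have dU' : \dim (U :&: orthov dot <[v]>)%VS = n by rewrite -eq_dim_orthov1 ?dU.
have [e /andP[on be]] := IH _ dU'.
pose v1 := (sqrtC (dot v v))^-1 *: v.
have v11 : dot v1 v1 = 1.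
  rewrite dnormZ normfV ger0_norm ?sqrtC_ge0 ?ltW // exprVn sqrtCK mulVf //.
  exact: lt0r_neq0.
have o1 : orthonormal dot (v1 :: e).
  rewrite -cat1s orthonormal_cat on andTb; apply/andP; split.
    by rewrite /orthonormal /= v11 eqxx.
  apply/orthoPl => w we.
  have /memv_capP[_] := basis_mem be we.
  rewrite mem_orthov1 herm_eq0C => /eqP vw.
  by rewrite linearZl_LR /= vw mulr0.
exists (v1 :: e); rewrite o1 /= basisEfree (orthonormal_free o1) /= dU.
have /andP[/eqP spe /eqP fre] := be.
rewrite -fre spe dU' leqnn andbT span_cons subv_add spe capvSl andbT.
by rewrite -memvE memvZ ?memv_pick.
Qed.

(* The Hilbert-Schmidt product computed in the basis [e]; an isometry statement
   has to hold for every orthonormal [e], and [orthonormal_basis_exists] shows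
   that there is one. *)
Definition hs_dot (V W : vectType C) (dotW : W -> W -> C) (e : seq V)
    (S T : 'Hom(V, W)) : C := \sum_(u <- e) dotW (S u) (T u).

Section Permutation.
Variables (X : finType) (act : gT -> X -> X).

Definition LX : vectType C := {ffun X -> C^o}.

Definition dotLX (f1 f2 : LX) : C := \sum_(x : X) f1 x * (f2 x)^*.

Definition perm_rep_fun (g : gT) (f : LX) : LX := [ffun x => f (act g^-1%g x)].

Lemma perm_rep_fun_is_linear g : linear (perm_rep_fun g).
Proof. by move=> a f1 f2; apply/ffunP => x; rewrite !ffunE. Qed.

HB.instance Definition _ g := GRing.isLinear.Build C LX LX *:%R
  (perm_rep_fun g) (perm_rep_fun_is_linear g).

Definition perm_rep (g : gT) : 'End(LX) := linfun (perm_rep_fun g).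

End Permutation.

Section TMap.
Variables (X : finType) (act : gT -> X -> X) (x0 : X).
Variables (V : vectType C) (dot : {dot V for Num.conj}) (rho : gT -> 'End(V)).

Definition transporter (x : X) : gT := odflt 1%g [pick g | act g x0 == x].

Definition T_fun (v w : V) : LX X :=
  [ffun x => sqrtC ((\dim {:V})%:R / #|X|%:R) *
             dot w (rho (transporter x) v)].

Lemma T_fun_is_linear v : linear (T_fun v).
Proof.
move=> a w1 w2; apply/ffunP => x; rewrite !ffunE linearPl /=.
by rewrite mulrDr [in LHS]mulrCA.
Qed.

HB.instance Definition _ v := GRing.isLinear.Build C V (LX X) *:%R
  (T_fun v) (T_fun_is_linear v).

Definition T_map (v : V) : 'Hom(V, LX X) := linfun (T_fun v).

(* For [K]-invariant [v] the value does not depend on the transporter. *)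
Lemma T_mapE v w g : is_left_action act -> is_rep rho ->
    v \in invariants rho (stabilizer act x0) ->
  T_map v w (act g x0) =
    sqrtC ((\dim {:V})%:R / #|X|%:R) * dot w (rho g v).
Proof.
move=> [a1 aM] [r1 rM] /mem_invariants vK.
rewrite /T_map lfunE /= ffunE /transporter; congr (_ * dot w _).
case: pickP => [h /eqP /= hE|/(_ g)]; last by rewrite eqxx.
have kK : (g^-1 * h)%g \in stabilizer act x0.
  by rewrite inE aM hE -aM mulVg a1.
by rewrite -[h](mulKVg g) rM comp_lfunE vK.
Qed.

End TMap.

(* For an antilinear map, preserving inner products means
   [<f u, f v> = <v, u>]. *)
Definition antilinear_isometric_iso (V W : vectType C) (A : {vspace V})
    (B : {vspace W}) (dotV : V -> V -> C) (dotW : W -> W -> C) (f : V -> W) :=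
  [/\ {in A, forall v, f v \in B},
      forall a, {in A &, forall u v, f (a *: u + v) = a^* *: f u + f v},
      {in A &, forall u v, dotW (f u) (f v) = dotV v u},
      {in A &, injective f} &
      {in B, forall T, exists2 v, v \in A & f v = T}].

End Representations.

(* Main.v *)
From HB Require Import structures.
Require Import Defs.
From mathcomp Require Import all_boot all_order all_algebra all_fingroup.
From mathcomp Require Import boolp reals complex.

Set Implicit Arguments.
Unset Strict Implicit.
Unset Printing Implicit Defensive.

Import Order.TTheory GRing.Theory Num.Theory.
Import passmx.

Local Open Scope ring_scope.

(** The heart of the matter is evaluation at the base point.  An intertwiner T
    from V to L(X) is determined by the linear functional sending w to
    (T w)(x0), because the action is transitive and T commutes with it.  By
    Riesz this functional is w |-> <w, z> for a unique z; that T w is moved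
    along by the permutation representation then says
    (T w)(g x0) = <w, rho(g) z>, and invariance of z under K is exactly what
    makes this formula consistent on the stabilizer.  Thus v |-> T_v / sqrt(d)
    is a bijection ([reciprocity_inj], [reciprocity_surj]), and it is antilinear
    because inner products are antilinear in their second variable.

    The factor sqrt(d / |X|) in T_v and the factor 1 / sqrt(d) combine to
    1 / sqrt(|X|).  The Hilbert-Schmidt product of the images of u and v is
    therefore the average over the points g x0 of
    \sum_e <e, rho(g) u> <rho(g) v, e>, and Parseval together with unitarity
    turns each of these sums into <v, u> ([reciprocity_isometry]).

    For the multiplicity, L(X) is a direct sum of irreducible subspaces by
    Maschke's theorem ([irreducible_decomposition]).  In any such decomposition
    of a representation W, Schur's lemma says that the projections of an
    intertwiner V -> W to the summands vanish outside the summands equivalent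
    to V and are scalar multiples of a fixed embedding on the others; hence the
    number of these summands is the dimension of Hom_G(V, W)
    ([dim_homG_multiplicity]).  The antilinear bijection identifies that
    dimension with the dimension of V^K ([dim_antilinear_iso]). *)

(** * Schur's lemma *)

Lemma lfun_eigenvector (C : numClosedFieldType) (V : vectType C)
    (f : 'End(V)) :
  fullv != 0%VS :> {vspace V} -> exists a (v : V), v != 0 /\ f v = a *: v.
Proof.
rewrite -dimv_eq0 -lt0n => V_gt0.
have bV := vbasisP {:V}.
have [a a_eig] := eigenvalue_closed (mxof (vbasis {:V}) (vbasis {:V}) f) V_gt0.
exists a, (vpick (leigenspace f a)); split.
  by rewrite vpick0 (leigenspaceE bV) (vsof_eq0 bV).
have := memv_pick (leigenspace f a).
rewrite /leigenspace memv_ker !lfun_simp subr_eq0.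
by move/eqP.
Qed.

Section Intertwiners.
Variables (C : numClosedFieldType) (gT : finGroupType).
Variables (V W : vectType C) (rho : gT -> 'End(V)) (lam : gT -> 'End(W)).
Implicit Types (S T : 'Hom(V, W)) (U : {vspace W}).

Lemma intertwinerP T :
  T \in homG rho lam <-> forall g v, T (rho g v) = lam g (T v).
Proof.
rewrite mem_homG; split=> [TG g v|TG g].
  by have /lfunP/(_ v) := TG g; rewrite !comp_lfunE.
by apply/lfunP => v; rewrite !comp_lfunE TG.
Qed.

Lemma stable_lker T : T \in homG rho lam -> stable rho (lker T).
Proof.
move=> /intertwinerP TG g; apply/subvP => _ /memv_imgP[v vK ->].
by move: vK; rewrite !memv_ker TG => /eqP->; rewrite linear0.
Qed.

Lemma stable_limg T : T \in homG rho lam -> stable lam (limg T).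
Proof.
move=> /intertwinerP TG g; apply/subvP => _ /memv_imgP[_ /memv_imgP[v _ ->] ->].
by rewrite -TG memv_img ?memvf.
Qed.

(** The kernel of an intertwiner is stable in V and its image is stable in U, so
    irreducibility leaves only the extreme cases for each. *)
Lemma schur_dichotomy U T : irreducible_rep rho -> irreducible_on lam U ->
  T \in homG rho lam -> (limg T <= U)%VS ->
  T = 0 \/ (lker T = 0%VS /\ limg T = U).
Proof.
move=> [V0 _ irrV] [_ _ irrU] TG TU.
have [kT|kT] := irrV _ (subvf _) (stable_lker TG); last first.
  left; apply/lfunP => v; rewrite lfunE /=; apply/eqP.
  by rewrite -memv_ker kT memvf.
have [iT|iT] := irrU _ TU (stable_limg TG); last by right.
left; apply/lfunP => v; rewrite lfunE /=; apply/eqP.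
by rewrite -memv0 -iT memv_img ?memvf.
Qed.

(** A nonzero T is an isomorphism onto U, so [T^-1 \o S] is an endomorphism of V
    and has an eigenvalue c.  Then S - c T is an intertwiner into U with a
    nontrivial kernel, hence zero. *)
Lemma schur_scalar U S T : irreducible_rep rho -> irreducible_on lam U ->
  S \in homG rho lam -> (limg S <= U)%VS ->
  T \in homG rho lam -> (limg T <= U)%VS -> T != 0 ->
  exists c, S = c *: T.
Proof.
move=> irrV irrU SG SU TG TU T0.
have [/eqP|[kT iT]] := schur_dichotomy irrV irrU TG TU; first by rewrite (negPf T0).
have V0 : fullv != 0%VS :> {vspace V} by case: irrV => /eqP.
have [c [v [v0 vE]]] := lfun_eigenvector (T^-1 \o S)%VF V0.
exists c; apply/eqP; rewrite -subr_eq0; apply/eqP.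
have DU : (limg (S - c *: T) <= U)%VS.
  apply/subvP => _ /memv_imgP[w _ ->]; rewrite !lfun_simp.
  have /(subvP SU) ? := memv_img S (memvf w).
  have /(subvP TU) ? := memv_img T (memvf w).
  by rewrite memvB ?memvZ.
have DG : S - c *: T \in homG rho lam by rewrite rpredB ?rpredZ.
have [//|[kD _]] := schur_dichotomy irrV irrU DG DU.
have ST : S v = c *: T v.
  transitivity (T (c *: v)); last by rewrite linearZ.
  rewrite -vE comp_lfunE limg_lfunVK //.
  by rewrite iT (subvP SU) ?memv_img ?memvf.
have : v \in lker (S - c *: T) by rewrite memv_ker !lfun_simp ST subrr.
by rewrite kD memv0 (negPf v0).
Qed.

(** Choose an embedding of V onto each summand equivalent to it.  These
    embeddings form a basis of the space of intertwiners: they are independent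
    since their images lie in independent subspaces, and an intertwiner is the
    sum of its projections to the summands, each of which is zero or, by Schur's
    lemma, proportional to the chosen embedding. *)
Lemma dim_homG_multiplicity n (U : 'I_n -> {vspace W}) :
  irreducible_rep rho ->
  (\sum_(i < n) U i = fullv)%VS -> directv (\sum_(i < n) U i) ->
  (forall i, irreducible_on lam (U i)) ->
  \dim (homG rho lam) = #|[set i | `[< equivalent_to_sub rho lam (U i) >]]|.
Proof.
move=> irrV sumU dirU irrU; set A := [set i | _].
have V0 : fullv != 0%VS :> {vspace V} by case: irrV => /eqP.
have embed i : exists T : 'Hom(V, W), i \in A ->
    [/\ T \in homG rho lam, lker T = 0%VS & limg T = U i].
  have [/[!inE]/asboolP[T TP]|_] := boolP (i \in A); first by exists T.
  by exists 0.
(* The value of [T] outside [A] is arbitrary; a total family is easier to sum. *)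
have [/= T TP] := choice embed.
pose p i := sumv_pi_for (esym sumU) i.
have pU i w : p i w \in U i by apply: memv_sum_pi.
have sum_p w : \sum_i p i w = w by apply: sumv_pi_sum; rewrite memvf.
have p_uniq (u : 'I_n -> W) : (forall i, u i \in U i) ->
    forall i, p i (\sum_j u j) = u i.
  move=> uU i; have /directv_sum_unique dU := dirU.
  have := dU (fun j => p j (\sum_j u j)) u (fun j _ => pU j _) (fun j _ => uU j).
  by rewrite sum_p eqxx => /esym/forall_inP/(_ i isT)/eqP.
(* Since every [U j] is stable, applying [lam g] to the decomposition of [w]
   gives the decomposition of [lam g w]. *)
have p_lam i g w : p i (lam g w) = lam g (p i w).
  rewrite -{1}[w]sum_p linear_sum; apply: (p_uniq (fun j => lam g (p j w))) => j.
  have [_ sU _] := irrU j.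
  by apply: (subvP (sU g)); rewrite memv_img.
have pG i S : S \in homG rho lam -> (p i \o S)%VF \in homG rho lam.
  move=> /intertwinerP SG; apply/intertwinerP => g v.
  by rewrite !comp_lfunE SG p_lam.
have pSU i S : (limg (p i \o S) <= U i)%VS.
  by apply/subvP => _ /memv_imgP[v _ ->]; rewrite comp_lfunE pU.
have pE i j w : w \in U j -> p i w = if i == j then w else 0.
  move=> wU; pose u k := if k == j then w else 0.
  have uw : \sum_k u k = w by rewrite -big_mkcond big_pred1_eq.
  rewrite -[in LHS]uw p_uniq // => k.
  by rewrite /u; case: eqP => [->|_]; rewrite ?mem0v.
(* One nonzero vector suffices to separate the embeddings. *)
pose v := vpick {:V}; have v0 : v != 0 by rewrite vpick0.
have Tv0 i : i \in A -> T i v != 0.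
  by move=> /TP[_ kT _]; rewrite -memv_ker kT memv0.
have TU i w : i \in A -> T i w \in U i.
  by move=> /TP[_ _ <-]; rewrite memv_img ?memvf.
pose b := [tuple T (enum_val i) | i < #|A|].
suff : basis_of (homG rho lam) b by move=> /size_basis.
have bE (i : 'I_#|A|) : b`_i = T (enum_val i) by rewrite -tnth_nth tnth_mktuple.
have b_span i : i \in A -> T i \in <<b>>%VS.
  move=> iA; rewrite -(enum_rankK_in iA iA) -bE memv_span // mem_nth //.
  by rewrite size_tuple.
rewrite /basis_of eqEsubv -andbA; apply/and3P; split.
- by apply/span_subvP => _ /mapP[i _ ->]; have [] := TP _ (enum_valP i).
- apply/subvP => S SG.
  have -> : S = \sum_i (p i \o S)%VF.
    apply/lfunP => w; rewrite sum_lfunE -[LHS]sum_p.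
    by apply: eq_bigr => i _; rewrite comp_lfunE.
  apply: rpred_sum => i _.
  have [->|nz] := eqVneq (p i \o S)%VF 0; first exact: mem0v.
  have [/eqP|[kS iS]] := schur_dichotomy irrV (irrU i) (pG i S SG) (pSU i S).
    by rewrite (negPf nz).
  have iA : i \in A.
    by rewrite inE; apply/asboolP; exists (p i \o S)%VF; rewrite pG.
  have [TG _ iT] := TP i iA.
  have T0 : T i != 0.
    by apply: contraNneq (Tv0 i iA) => ->; rewrite lfunE.
  have [|c ->] := schur_scalar irrV (irrU i) (pG i S SG) (pSU i S) TG _ T0.
    by rewrite iT.
  by rewrite memvZ ?b_span.
- apply/freeP => k /lfunP/(_ v) /= sum0 j.
  have := congr1 (p (enum_val j)) sum0.
  rewrite lfunE linear0 sum_lfunE linear_sum (bigD1 j) //= bE big1 => [|i ij].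
    rewrite addr0 lfunE linearZ /= (pE _ (enum_val j)) ?TU ?enum_valP //.
    rewrite eqxx => /eqP; rewrite scaler_eq0 (negPf (Tv0 _ (enum_valP _))) orbF.
    by move/eqP.
  rewrite bE lfunE linearZ /= (pE _ (enum_val i)) ?TU ?enum_valP //.
  by rewrite (inj_eq enum_val_inj) eq_sym (negPf ij) scaler0.
Qed.

End Intertwiners.

(** * Complete reducibility *)

Section CompleteReducibility.
Variables (C : numClosedFieldType) (gT : finGroupType).
Variables (W : vectType C) (lam : gT -> 'End(W)).
Hypothesis lam_rep : is_rep lam.
Implicit Types (U P Q : {vspace W}).

Lemma rep_mul g h w : lam (g * h)%g w = lam g (lam h w).
Proof. by have [_ ->] := lam_rep; rewrite comp_lfunE. Qed.

Lemma rep_invK g : cancel (lam g^-1%g) (lam g).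
Proof.
by move=> w; rewrite -rep_mul mulgV; have [-> _] := lam_rep; rewrite lfunE.
Qed.

Lemma rep_Kinv g : cancel (lam g) (lam g^-1%g).
Proof. by move=> w; rewrite -{2}[g]invgK rep_invK. Qed.

(** Averaging the conjugates of a linear projection onto U over the group gives
    an equivariant projection onto U, whose kernel is a stable complement. *)
Lemma maschke U : stable lam U ->
  exists2 Q, stable lam Q & (U + Q = fullv)%VS /\ (U :&: Q = 0)%VS.
Proof.
move=> sU.
pose avg : 'End(W) :=
  #|gT|%:R^-1 *: \sum_(g : gT) (lam g \o projv U \o lam g^-1%g)%VF.
have avgE w : avg w = #|gT|%:R^-1 *: \sum_(g : gT) lam g (projv U (lam g^-1%g w)).
  rewrite /avg lfunE /= sum_lfunE; congr (_ *: _).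
  by apply: eq_bigr => g _; rewrite !comp_lfunE.
have stabU g w : w \in U -> lam g w \in U.
  by move=> wU; apply: (subvP (sU g)); rewrite memv_img.
have avgU w : avg w \in U.
  by rewrite avgE memvZ // rpred_sum // => g _; rewrite stabU ?memv_proj.
have avg_id w : w \in U -> avg w = w.
  move=> wU; rewrite avgE (eq_bigr (fun=> w)) => [|g _].
    rewrite sumr_const -scaler_nat scalerA mulVf ?scale1r // pnatr_eq0.
    by rewrite -lt0n; apply/card_gt0P; exists 1%g.
  by rewrite projv_id ?rep_invK ?stabU.
have avg_lam h w : avg (lam h w) = lam h (avg w).
  rewrite !avgE [RHS]linearZ (linear_sum (lam h)) (reindex_inj (mulgI h)) /=.
  congr (_ *: _).
  by apply: eq_bigr => g _; rewrite rep_mul invMg rep_mul rep_Kinv.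
exists (lker avg).
  move=> g; apply/subvP => _ /memv_imgP[w + ->].
  by rewrite !memv_ker avg_lam => /eqP->; rewrite linear0.
split.
  apply/eqP; rewrite eqEsubv subvf; apply/subvP => w _.
  rewrite -[w](addrNK (avg w)) addrC memv_add // memv_ker linearB /=.
  by rewrite (avg_id (avg w)) ?subrr.
apply/eqP; rewrite -subv0; apply/subvP => w; rewrite memv_cap memv_ker memv0.
by case/andP => /avg_id ->.
Qed.

Lemma maschke_in P U : stable lam P -> stable lam U -> (P <= U)%VS ->
  exists Q, [/\ stable lam Q, (P + Q = U)%VS & (P :&: Q = 0)%VS].
Proof.
move=> sP sU PU; have [Q sQ [PQ PQ0]] := maschke sP.
exists (U :&: Q)%VS; split.
- move=> g; apply: subv_trans (limg_cap _ _ _) _.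
  by rewrite capvS ?sU ?sQ.
- by rewrite capvC vspace_modl // PQ; apply/capv_idPr/subvf.
- apply/eqP; rewrite -subv0 -PQ0; exact: capvS (subvv P) (capvSr U Q).
Qed.

(** Directness is expressed by the additivity of dimensions, which unlike a
    statement about independent families is immediate to maintain when the
    decompositions of two complementary subspaces are concatenated. *)
Lemma complete_reducibility U : stable lam U ->
  exists s : seq {vspace W},
    [/\ {in s, forall P, irreducible_on lam P}, (\sum_(P <- s) P = U)%VS &
        (\sum_(P <- s) \dim P)%N = \dim U].
Proof.
have [n] := ubnP (\dim U); elim: n U => // n IH U.
rewrite ltnS => dU sU.
have [->|U0] := eqVneq U 0%VS.
  by exists [::]; split=> //; rewrite !big_nil ?dimv0.
have [irrU|redU] := pselect (irreducible_on lam U).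
  by exists [:: U]; split=> [P /[!inE]/eqP->||] //; rewrite !big_seq1.
have [P [PU sP P0 PnU]] : exists P,
    [/\ (P <= U)%VS, stable lam P, P != 0%VS & P != U].
  apply: contrapT => noP; apply: redU; split=> // [|P PU sP]; first exact/eqP.
  have [->|P0] := eqVneq P 0%VS; first by left.
  have [->|PnU] := eqVneq P U; first by right.
  by case: noP; exists P.
have [Q [sQ PQ PQ0]] := maschke_in sP sU PU.
have dPQ : (\dim P + \dim Q)%N = \dim U by rewrite -PQ dimv_disjoint_sum.
have P_gt0 : (0 < \dim P)%N by rewrite lt0n dimv_eq0.
have Q_gt0 : (0 < \dim Q)%N.
  rewrite lt0n dimv_eq0; apply: contra_neq PnU => Q0.
  by rewrite -PQ Q0 addv0.
have [|s [irr_s sum_s dim_s]] := IH P _ sP.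
  by apply: leq_trans dU; rewrite -dPQ -addn1 leq_add2l.
have [|t [irr_t sum_t dim_t]] := IH Q _ sQ.
  by apply: leq_trans dU; rewrite -dPQ -add1n leq_add2r.
exists (s ++ t); rewrite !big_cat /= sum_s sum_t dim_s dim_t; split=> // A.
by rewrite mem_cat => /orP[/irr_s|/irr_t].
Qed.

Lemma irreducible_decomposition : exists n (U : 'I_n -> {vspace W}),
  [/\ (\sum_(i < n) U i = fullv)%VS, directv (\sum_(i < n) U i) &
      forall i, irreducible_on lam (U i)].
Proof.
have [|s [irr_s sum_s dim_s]] := @complete_reducibility fullv.
  by move=> g; apply: subvf.
exists (size s), (tnth (in_tuple s)).
have sumE : (\sum_(i < size s) tnth (in_tuple s) i)%VS = fullv.
  by rewrite -sum_s [RHS]big_tnth.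
split=> [||i] //; last by apply: irr_s; apply: mem_tnth.
by rewrite directvE /= sumE -dim_s big_tnth.
Qed.

End CompleteReducibility.

(** Any decomposition into irreducibles counts [\dim (homG rho lam)] copies of V,
    and complete reducibility provides a decomposition. *)
Lemma is_multiplicityE (C : numClosedFieldType) (gT : finGroupType)
    (V W : vectType C) (rho : gT -> 'End(V)) (lam : gT -> 'End(W)) m :
  is_rep lam -> irreducible_rep rho ->
  is_multiplicity rho lam m <-> m = \dim (homG rho lam).
Proof.
move=> lam_rep irrV; split=> [[n [U [sumU dirU irrU ->]]]|->].
  by rewrite (dim_homG_multiplicity irrV sumU dirU irrU).
have [n [U [sumU dirU irrU]]] := irreducible_decomposition lam_rep.
by exists n, U; split=> //; apply: dim_homG_multiplicity.
Qed.

(** The linear theory of dimensions does not apply to an antilinear f, but f still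
    sends a basis of A to a basis of B: it maps linear combinations to linear
    combinations with conjugated coefficients. *)
Lemma dim_antilinear_iso (C : numClosedFieldType) (V W : vectType C)
    (A : {vspace V}) (B : {vspace W}) (f : V -> W) :
  {in A, forall v, f v \in B} ->
  (forall a, {in A &, forall u v, f (a *: u + v) = a^* *: f u + f v}) ->
  {in A &, injective f} ->
  {in B, forall T, exists2 v, v \in A & f v = T} ->
  \dim A = \dim B.
Proof.
move=> fB f_lin f_inj f_surj.
have f0 : f 0 = 0.
  have := f_lin (-1) 0 0.
  by rewrite mem0v scaler0 addr0 rmorphN1 scaleN1r addNr; apply.
have f_sum (k : 'I_(\dim A) -> C) :
    f (\sum_i k i *: (vbasis A)`_i) = \sum_i (k i)^* *: f (vbasis A)`_i.
  pose S (r : seq 'I_(\dim A)) := \sum_(i <- r) k i *: (vbasis A)`_i.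
  suff [_ ->] : S (index_enum _) \in A /\
      f (S (index_enum _)) = \sum_i (k i)^* *: f (vbasis A)`_i by [].
  have bA (i : 'I_(\dim A)) : (vbasis A)`_i \in A.
    by rewrite vbasis_mem // mem_nth ?size_tuple.
  elim: (index_enum _) => [|i r [SA fS]].
    by rewrite /S !big_nil mem0v f0.
  rewrite /S !big_cons f_lin ?bA // -fS; split=> //.
  by rewrite memvD ?memvZ ?bA.
pose b := [tuple of map f (vbasis A)].
have bE (i : 'I_(\dim A)) : b`_i = f (vbasis A)`_i.
  by rewrite (nth_map 0) ?size_tuple.
suff /size_basis-> : basis_of B b by [].
rewrite /basis_of eqEsubv -andbA; apply/and3P; split.
- apply/span_subvP => _ /mapP[v vA ->]; exact/fB/vbasis_mem.
- apply/subvP => _ /f_surj[v vA <-]; rewrite (coord_vbasis vA) f_sum.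
  by apply: rpred_sum => i _; rewrite memvZ // -bE memv_span ?mem_nth ?size_tuple.
- apply/freeP => k.
  under eq_bigr do rewrite bE -[k _]conjCK.
  rewrite -f_sum -f0 => /f_inj sum0 i; apply/eqP; rewrite -conjC_eq0; apply/eqP.
  have /freeP A_free := basis_free (vbasisP A).
  apply: (A_free (fun i => (k i)^*)); apply: sum0; rewrite ?mem0v //.
  apply: rpred_sum => l _.
  by rewrite memvZ ?vbasis_mem ?mem_nth ?size_tuple.
Qed.

(** * Expansions in an orthonormal basis *)

Lemma dot_conj (C : numClosedFieldType) (V : vectType C)
    (dot : {dot V for Num.conj}) v w : (dot v w)^* = dot w v.
Proof. by rewrite [RHS]hermC expr0 mul1r. Qed.

Lemma dot_ext (C : numClosedFieldType) (V : vectType C)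
    (dot : {dot V for Num.conj}) u v :
  (forall w, dot w u = dot w v) -> u = v.
Proof.
move=> uv; apply/eqP; rewrite -subr_eq0 -(dnorm_eq0 dot).
by rewrite [X in X == _]linearBr subr_eq0; apply/eqP/uv.
Qed.

Section Orthonormal.
Variables (C : numClosedFieldType) (V : vectType C).
Variables (dot : {dot V for Num.conj}) (e : seq V).
Hypothesis e_onb : orthonormal_basis dot e.

(** The difference of the two sides is orthogonal to the basis, hence to itself. *)
Lemma orthonormal_expansion v : v = \sum_(u <- e) dot v u *: u.
Proof.
have [e_on /andP[/eqP e_span _]] := andP e_onb.
have [e_uniq eE] := orthonormalP e_on.
set w := \sum_(u <- e) _; apply/eqP; rewrite -subr_eq0 -(dnorm_eq0 dot).
have e_all x : x \in <<e>>%VS by rewrite e_span memvf.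
apply/eqP/(span_orthogonal (S1 := [:: v - w]) (S2 := e)) => //.
  apply/orthoPl => u ue; rewrite linearBl /= {}/w linear_sumlz /=.
  rewrite (bigD1_seq u) //= big_seq_cond big1 => [|t /andP[te tu]].
    by rewrite linearZl_LR /= (eE u u) // eqxx mulr1 addr0 subrr.
  by rewrite linearZl_LR /= (eE t u) // (negPf tu) mulr0.
by rewrite memv_span ?mem_head.
Qed.

Lemma parseval v w : dot v w = \sum_(u <- e) dot v u * (dot w u)^*.
Proof.
rewrite {1}[v]orthonormal_expansion linear_sumlz /=; apply: eq_bigr => u _.
by rewrite linearZl_LR /= dot_conj.
Qed.

End Orthonormal.

Lemma riesz_representation (C : numClosedFieldType) (V : vectType C)
    (dot : {dot V for Num.conj}) (phi : V -> C) :
  (forall a u v, phi (a *: u + v) = a * phi u + phi v) ->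
  exists z, forall w, phi w = dot w z.
Proof.
move=> phi_lin; have [e e_onb] := orthonormal_basis_exists dot.
pose phiM := GRing.isLinear.Build C V C^o *:%R phi phi_lin.
pose phiL : {linear V -> C^o} := HB.pack phi phiM.
exists (\sum_(u <- e) (phi u)^* *: u) => w.
rewrite {1}(orthonormal_expansion e_onb w) -[phi]/(phiL : V -> C^o) linear_sum.
rewrite linear_sumr; apply: eq_bigr => u _.
by rewrite linearZ linearZr_LR /= conjCK mulrC.
Qed.

(** * The reciprocity map *)

Section Reciprocity.
Variables (C : numClosedFieldType) (gT : finGroupType) (X : finType).
Variables (act : gT -> X -> X) (x0 : X) (V : vectType C).
Variables (dot : {dot V for Num.conj}) (rho : gT -> 'End(V)).
Hypotheses (act_left : is_left_action act) (act_trans : is_transitive act).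
Hypotheses (rho_rep : is_rep rho) (rho_unitary : unitary_rep dot rho).
Hypothesis V_neq0 : fullv != 0%VS :> {vspace V}.

Local Notation VK := (invariants rho (stabilizer act x0)).
Local Notation lambda := (perm_rep C act).

Definition reciprocity (v : V) : 'Hom(V, LX C X) :=
  (sqrtC (\dim {:V})%:R)^-1 *: T_map act x0 dot rho v.

(* What remains of the normalization: sqrt(d / |X|) / sqrt(d) = 1 / sqrt(|X|). *)
Let kappa : C := sqrtC (#|X|%:R^-1).

Lemma cardX_neq0 : #|X|%:R != 0 :> C.
Proof. by rewrite pnatr_eq0 -lt0n; apply/card_gt0P; exists x0. Qed.

Lemma kappa_neq0 : kappa != 0.
Proof. by rewrite sqrtC_eq0 invr_eq0 cardX_neq0. Qed.

Lemma kappa_norm : kappa * kappa^* = #|X|%:R^-1.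
Proof.
by rewrite geC0_conj ?sqrtC_ge0 ?invr_ge0 ?ler0n // -expr2 sqrtCK.
Qed.

Lemma reciprocityE v w g : v \in VK ->
  reciprocity v w (act g x0) = kappa * dot w (rho g v).
Proof.
move=> vK; rewrite /reciprocity lfunE /= ffunE T_mapE //.
rewrite sqrtCM ?qualifE /= ?invr_ge0 ?ler0n //.
rewrite [LHS]mulrA mulKf // sqrtC_eq0 pnatr_eq0 dimv_eq0.
exact: V_neq0.
Qed.

Lemma perm_repE g f x : lambda g f x = f (act g^-1%g x).
Proof. by rewrite lfunE /= ffunE. Qed.

Lemma perm_rep_is_rep : is_rep lambda.
Proof.
have [act1 actM] := act_left; split=> [|g h]; apply/lfunP => f; apply/ffunP => x.
  by rewrite perm_repE lfunE /= invg1 act1.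
by rewrite comp_lfunE !perm_repE invMg actM.
Qed.

(** Transitivity: every point of X is a translate of x0. *)
Lemma LX_hom_ext (S T : 'Hom(V, LX C X)) :
  (forall w g, S w (act g x0) = T w (act g x0)) -> S = T.
Proof.
move=> ST; apply/lfunP => w; apply/ffunP => x.
by have [g <-] := act_trans x0 x.
Qed.

Lemma reciprocity_homG v : v \in VK -> reciprocity v \in homG rho lambda.
Proof.
have [_ actM] := act_left.
move=> vK; apply/intertwinerP => g w; apply/ffunP => x.
have [h <-] := act_trans x0 x.
rewrite perm_repE -actM !reciprocityE // -[in RHS](rho_unitary g).
by rewrite -(rep_mul rho_rep) mulKVg.
Qed.

Lemma reciprocity_antilinear a :
  {in VK &, forall u v,
     reciprocity (a *: u + v) = a^* *: reciprocity u + reciprocity v}.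
Proof.
move=> u v uK vK; apply: LX_hom_ext => w g.
rewrite [in RHS]lfunE /= ffunE [in RHS]lfunE /= ffunE.
rewrite !reciprocityE ?memvD ?memvZ // linearP linearDr linearZr_LR /=.
by rewrite mulrDr [in LHS]mulrCA.
Qed.

(** Parseval gives <rho(g) v, rho(g) u> = <v, u> as the contribution of each point
    g x0, and kappa squared averages over the |X| points. *)
Lemma reciprocity_isometry e : orthonormal_basis dot e ->
  {in VK &, forall u v,
     hs_dot (@dotLX C X) e (reciprocity u) (reciprocity v) = dot v u}.
Proof.
move=> e_onb u v uK vK; rewrite /hs_dot /dotLX exchange_big /=.
rewrite (eq_bigr (fun=> #|X|%:R^-1 * dot v u)) => [|x _].
  by rewrite sumr_const -[LHS]mulr_natl mulVKf ?cardX_neq0.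
have [g <-] := act_trans x0 x.
rewrite -(rho_unitary g) (parseval e_onb) mulr_sumr; apply: eq_bigr => w _.
rewrite !reciprocityE // rmorphM /= mulrACA kappa_norm; congr (_ * _).
by rewrite !dot_conj mulrC.
Qed.

(** The value of the image of v at x0 recovers the functional <., v>, hence v. *)
Lemma reciprocity_inj : {in VK &, injective reciprocity}.
Proof.
have [act1 _] := act_left; have [rho1 _] := rho_rep.
move=> u v uK vK uv; apply: (dot_ext (dot := dot)) => w; apply: (mulfI kappa_neq0).
have E t : t \in VK -> kappa * dot w t = reciprocity t w (act 1%g x0).
  by move=> tK; rewrite reciprocityE // rho1 lfunE.
by rewrite !E // uv.
Qed.

(** The preimage comes from the vector z representing w |-> (T w)(x0).  An element
    g of the stabilizer fixes z because <w, rho(g) z> = (T w)(g x0) = (T w)(x0). *)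
Lemma reciprocity_surj :
  {in homG rho lambda, forall T, exists2 v, v \in VK & reciprocity v = T}.
Proof.
have [act1 actM] := act_left.
move=> T /intertwinerP TG.
have [|z zE] := @riesz_representation _ _ dot (fun w => T w x0).
  by move=> a u v; rewrite linearP !ffunE.
have TE w g : T w (act g x0) = dot w (rho g z).
  rewrite -(rep_invK rho_rep g w) rho_unitary -zE TG perm_repE -actM mulVg.
  by rewrite act1.
have zK : z \in VK.
  apply/mem_invariants => g; rewrite inE => /eqP gx0.
  by apply: (dot_ext (dot := dot)) => w; rewrite -TE gx0 zE.
(* The scalar is conjugated because the map is antilinear. *)
exists ((kappa^-1)^* *: z); first by rewrite memvZ.
apply: LX_hom_ext => w g; rewrite reciprocityE ?memvZ // TE.
by rewrite linearZ linearZr_LR /= conjCK mulVKf // kappa_neq0.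
Qed.

Lemma dim_invariants_homG : \dim VK = \dim (homG rho lambda).
Proof.
exact: dim_antilinear_iso reciprocity_homG reciprocity_antilinear
  reciprocity_inj reciprocity_surj.
Qed.

End Reciprocity.

Theorem theorem2p6 (R : realType) (gT : finGroupType) (X : finType)
    (act : gT -> X -> X) (x0 : X) (V : vectType R[i])
    (dot : {dot V for Num.conj}) (rho : gT -> 'End(V)) :
  is_left_action act ->
  is_transitive act ->
  is_rep rho ->
  unitary_rep dot rho ->
  irreducible_rep rho ->
  let K := stabilizer act x0 in
  let VK := invariants rho K in
  let lambda := perm_rep R[i] act in
  let d : R[i] := (\dim {:V})%:R in
  VK <> 0%VS ->
  (forall e : seq V, orthonormal_basis dot e ->
     antilinear_isometric_iso VK (homG rho lambda)
       dot (hs_dot (@dotLX R[i] X) e)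
       (fun v => (sqrtC d)^-1 *: T_map act x0 dot rho v)) /\
  (forall m : nat, is_multiplicity rho lambda m <-> m = \dim VK).
Proof.
move=> act_left act_trans rho_rep rho_unitary irrV K VK lambda d _.
have V_neq0 : fullv != 0%VS :> {vspace V} by case: irrV => /eqP.
split=> [e e_onb|m].
  split.
  - exact: reciprocity_homG.
  - exact: reciprocity_antilinear.
  - exact: reciprocity_isometry.
  - exact: reciprocity_inj.
  - exact: reciprocity_surj.
rewrite (is_multiplicityE _ (perm_rep_is_rep _ act_left) irrV).
by rewrite (dim_invariants_homG x0 act_left act_trans rho_rep rho_unitary).
Qed.
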